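(* Let $H$ be a Hadamard manifold, $E\subseteq H$ a nonempty open geodesic convex set, $\phi_s:E\to\mathbb{I}$, $\phi_s(p)=[\phi_s^L(p),\phi_s^U(p)]$, $s\in\{1,\dots,l\}$, and $\psi_u:E\to\mathbb{R}$, $u\in\{1,\dots,t\}$, $F=\{p\in E:\psi_u(p)\le0,\ u=1,\dots,t\}$, and consider the problem (MIVOP2) of minimizing $\phi=(\phi_1,\dots,\phi_l)$ over $F$. Let $\bar p\in F$ and $J(\bar p)=\{u\in\{1,\dots,t\}:\psi_u(\bar p)=0\}$. Assume that all $\psi_u$ are directionally differentiable at $\bar p$, that $\psi_u$, $u\in J(\bar p)$, are strictly pseudo-convex at $\bar p$, and that there exists $c\in\{1,\dots,l\}$ such that $\phi_c$ is weakly directionally differentiable at $\bar p$. (a) Let $X\in\{L,U\}$. If $\phi_c$ is strictly $X$-pseudo-convex at $\bar p$ and for every $p\in F$ there exist real numbers $\mu_u\ge0$, $u\in\{1,\dots,t\}$, such that (i) $(\phi_c^X)'(\bar p;\exp_{\bar p}^{-1}p)+\sum_{u=1}^{t}\mu_u\psi_u'(\bar p;\exp_{\bar p}^{-1}p)\ge0$; (ii) $\mu_u\psi_u(\bar p)=0$, $u\in\{1,\dots,t\}$, then $\bar p$ is a strongly type-I Pareto optimal solution of (MIVOP2). (b) Let $X\in\{C,W\}$. If $\phi_c$ is strictly $X$-pseudo-convex at $\bar p$ and for every $p\in F$ there exist real numbers $\mu_u\ge0$, $u\in\{1,\dots,t\}$, such that (iii) $(\phi_c^X)'(\bar p;\exp_{\bar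 p}^{-1}p)+\sum_{u=1}^{t}\mu_u\psi_u'(\bar p;\exp_{\bar p}^{-1}p)\ge0$; (iv) $\mu_u\psi_u(\bar p)=0$, $u\in\{1,\dots,t\}$, then $\bar p$ is a strongly type-II Pareto optimal solution of (MIVOP2).
   Context: A Hadamard manifold $H$ is a complete simply connected Riemannian manifold of non-positive sectional curvature; for $p\in H$ the map $\exp_p:T_p(H)\to H$ is a diffeomorphism with inverse $\exp_p^{-1}$, and the geodesic joining $p$ to $q$ is $\gamma_{p,q}(\alpha)=\exp_p(\alpha\exp_p^{-1}q)$, $\alpha\in[0,1]$. A set $E\subseteq H$ is geodesic convex if $\gamma_{p,q}(\alpha)\in E$ for all $p,q\in E$, $\alpha\in[0,1]$. The feasible set $F$ is assumed geodesic convex. For $f:E\to\mathbb{R}$, the directional derivative is $f'(p;w)=\lim_{\alpha\to0^+}\frac{f(\exp_p(\alpha w))-f(p)}{\alpha}$, $w\in T_p(H)$; $f$ is directionally differentiable at $p$ if it exists (finite) for all $w\in T_p(H)$. A directionally differentiable $f$ is strictly pseudo-convex at $\bar p\in E$ if for every $p\in E$ with $p\ne\bar p$, $f(p)\le f(\bar p)$ implies $f'(\bar p;\exp_{\bar p}^{-1}p)<0$; here only directional differentiability at $\bar p$ is required. $\mathbb{I}$ is the set of closed bounded intervals of $\mathbb{R}$. For $T=[t^L,t^U]$ put $t^C=\frac12(t^L+t^U)$, $t^W=\frac12(t^U-t^L)$. $T\leqq_{LU}S$ iff $t^L\le s^L$ and $t^U\le s^U$; $T\leqq_{CW}S$ iff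 $t^C\le s^C$ and $t^W\le s^W$. For tuples of intervals and either order, $T\leqq S$ means $T_k\leqq S_k$ for all $k$. For $f=[f^L,f^U]:E\to\mathbb{I}$ put $f^C=\frac12(f^L+f^U)$, $f^W=\frac12(f^U-f^L)$. $f$ is weakly directionally differentiable at $p$ if $f^L$ and $f^U$ are directionally differentiable at $p$. For $X\in\{L,U,C,W\}$, such an $f$ is strictly $X$-pseudo-convex at $\bar p$ if $f^X$ is strictly pseudo-convex at $\bar p$. $\bar p\in F$ is a strongly type-I (resp. strongly type-II) Pareto optimal solution of (MIVOP2) if there is no $\hat p\in F$, $\hat p\ne\bar p$, with $\phi(\hat p)\leqq_{LU}\phi(\bar p)$ (resp. $\phi(\hat p)\leqq_{CW}\phi(\bar p)$). *)

(* Defs.v *)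
From HB Require Import structures.
From mathcomp Require Import all_boot all_order all_algebra.
From mathcomp Require Import all_classical all_reals all_analysis.

Set Implicit Arguments.
Unset Strict Implicit.
Unset Printing Implicit Defensive.

Import Order.TTheory GRing.Theory Num.Theory.
Import numFieldNormedType.Exports.
Local Open Scope classical_set_scope.
Local Open Scope ring_scope.

(** For [V] finite-dimensional and [U] open this is the usual notion of class
    C^k, as directional derivatives in all directions include the partials. *)
Fixpoint class_C (R : realType) (V W : normedModType R) (k : nat) (U : set V)
    (f : V -> W) : Prop :=
  (forall x, U x -> {for x, continuous f}) /\
  match k with
  | 0 => True
  | k'.+1 => forall v, (forall x, U x -> derivable f x v) /\
                       class_C k' U ('D_v f)
  end.

Definition smooth_on (R : realType) (V W : normedModType R) (U : set V)
    (f : V -> W) : Prop := forall k, class_C k U f.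

(** [coords] is a homeomorphism from [dom] onto an open subset of R^n, with
    inverse [param]; values outside [dom] and [coords @` dom] are irrelevant. *)
Record chart (R : realType) (n : nat) (M : topologicalType) := Chart {
  dom : set M;
  coords : M -> 'rV[R]_n;
  param : 'rV[R]_n -> M;
  dom_open : open dom;
  coord_open : open (coords @` dom);
  coordK : forall p, dom p -> param (coords p) = p;
  coord_continuous : forall p, dom p -> {for p, continuous coords};
  param_continuous :
    forall x, (coords @` dom) x -> {for x, continuous param} }.

Definition transition (R : realType) (n : nat) (M : topologicalType)
  (c d : chart R n M) : 'rV[R]_n -> 'rV[R]_n := coords d \o param c.

Record smooth_atlas (R : realType) (n : nat) (M : topologicalType) :=
  SmoothAtlas {
  chart_index : Type;
  chart_at :> chart_index -> chart R n M;
  chart_cover : forall p, exists i, dom (chart_at i) p;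
  chart_compat : forall i j,
    smooth_on (coords (chart_at i) @` (dom (chart_at i) `&` dom (chart_at j)))
              (transition (chart_at i) (chart_at j)) }.

(** A tangent vector at [p] is the family of its components in the charts
    around [p], which are exchanged by the differentials of the transition
    maps.  Components in charts not containing [p] are set to 0, so that
    [tangent A p] is a linear subspace of the functions
    [chart_index A -> 'rV_n] of dimension [n]. *)
Definition tangent (R : realType) (n : nat) (M : topologicalType)
    (A : smooth_atlas R n M) (p : M) : set (chart_index A -> 'rV[R]_n) :=
  [set v | (forall i, ~ dom (A i) p -> v i = 0) /\
           (forall i j, dom (A i) p -> dom (A j) p ->
              v j = 'D_(v i) (transition (A i) (A j)) (coords (A i) p))].

Arguments tangent {R n M} A p.

Definition bilin (R : realType) (n : nat) (G : 'M[R]_n) (u v : 'rV[R]_n) : R :=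
  (u *m G *m v^T) 0 0.

(** [gram i x] is the Gram matrix of the metric in the chart [i], at the point
    of coordinates [x]. *)
Record riemannian_metric (R : realType) (n : nat) (M : topologicalType)
    (A : smooth_atlas R n M) := RiemannianMetric {
  gram : chart_index A -> 'rV[R]_n -> 'M[R]_n;
  gram_smooth : forall i a b,
    smooth_on (coords (A i) @` dom (A i)) (fun x => gram i x a b : R^o);
  gram_sym : forall i p, dom (A i) p ->
    (gram i (coords (A i) p))^T = gram i (coords (A i) p);
  gram_pos : forall i p, dom (A i) p -> forall v : 'rV[R]_n, v != 0 ->
    0 < bilin (gram i (coords (A i) p)) v v;
  gram_compat : forall i j p, dom (A i) p -> dom (A j) p ->
    forall u v : 'rV[R]_n,
    let dT w := 'D_w (transition (A i) (A j)) (coords (A i) p) in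
    bilin (gram i (coords (A i) p)) u v =
    bilin (gram j (coords (A j) p)) (dT u) (dT v) }.

Definition partial (R : realType) (n : nat) (a : 'I_n) (f : 'rV[R]_n -> R)
  (x : 'rV[R]_n) : R := 'D_(delta_mx 0 a) (f : 'rV[R]_n -> R^o) x.

Section RiemannianGeometry.
Variables (R : realType) (n : nat) (M : topologicalType).
Variables (A : smooth_atlas R n M) (g : riemannian_metric A).
Implicit Types (i : chart_index A) (x : 'rV[R]_n) (a b k l : 'I_n).

(** Gamma^k_{ab} *)
Definition christoffel i k a b x : R :=
  2^-1 * \sum_l invmx (gram g i x) k l *
    (partial a (fun y => gram g i y l b) x +
     partial b (fun y => gram g i y l a) x -
     partial l (fun y => gram g i y a b) x).

(** The component R^l_{kab} of the curvature tensor, i.e. the coefficient of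
    d_l in R(d_a, d_b) d_k, where
    R(X, Y) Z = D_X D_Y Z - D_Y D_X Z - D_[X, Y] Z. *)
Definition riemann i l k a b x : R :=
  partial a (christoffel i l b k) x - partial b (christoffel i l a k) x +
  \sum_m (christoffel i l a m x * christoffel i m b k x -
          christoffel i l b m x * christoffel i m a k x).

(** R(u, v) w *)
Definition curvature i x (u v w : 'rV[R]_n) : 'rV[R]_n :=
  \row_l \sum_a \sum_b \sum_k u 0 a * v 0 b * w 0 k * riemann i l k a b x.

Definition sectional_curvature i x (u v : 'rV[R]_n) : R :=
  let G := gram g i x in
  bilin G (curvature i x u v v) u /
  (bilin G u u * bilin G v v - bilin G u v ^+ 2).

Definition nonpositive_curvature : Prop :=
  forall i p, dom (A i) p -> forall u v : 'rV[R]_n,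
    row_free (col_mx u v) -> sectional_curvature i (coords (A i) p) u v <= 0.

(** Geodesics [R -> M], i.e. solutions for all times of
    c''^k + Gamma^k_{ab}(c) c'^a c'^b = 0 in local coordinates. *)
Definition geodesic (gam : R -> M) : Prop :=
  continuous gam /\
  forall (t : R) i, dom (A i) (gam t) ->
    let c := coords (A i) \o gam in
    let c' := derive1 c in
    let c'' := derive1 c' in
    [/\ derivable c t 1, derivable c' t 1 &
        forall k, c'' t 0 k +
          \sum_a \sum_b christoffel i k a b (c t) * c' t 0 a * c' t 0 b = 0].

Definition geodesic_from (p : M) (v : chart_index A -> 'rV[R]_n) (gam : R -> M) :
    Prop :=
  [/\ geodesic gam, gam 0 = p &
      forall i, dom (A i) p -> derive1 (coords (A i) \o gam) 0 = v i].

(** Equivalent to metric completeness by the Hopf-Rinow theorem. *)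
Definition geodesically_complete : Prop :=
  forall p v, tangent A p v -> exists gam, geodesic_from p v gam.

End RiemannianGeometry.

Definition path_connected_space (R : realType) (M : topologicalType) : Prop :=
  forall p q : M, exists gam : R -> M,
    [/\ {within `[0, 1], continuous gam}, gam 0 = p & gam 1 = q].

Definition simply_connected (R : realType) (M : topologicalType) : Prop :=
  path_connected_space R M /\
  forall gam : R -> M, {within `[0, 1], continuous gam} -> gam 0 = gam 1 ->
    exists h : R * R -> M,
      [/\ {within `[0, 1]%classic `*` `[0, 1]%classic, continuous h},
          forall t, 0 <= t <= 1 -> h (0, t) = gam t,
          forall t, 0 <= t <= 1 -> h (1, t) = gam 0 &
          forall s, 0 <= s <= 1 -> h (s, 0) = gam 0 /\ h (s, 1) = gam 0].

Record hadamard_manifold (R : realType) (n : nat) := HadamardManifold {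
  space :> topologicalType;
  atlas : smooth_atlas R n space;
  metric : riemannian_metric atlas;
  hm_hausdorff : hausdorff_space space;
  hm_second_countable : @second_countable space;
  hm_simply_connected : simply_connected R space;
  hm_complete : geodesically_complete metric;
  hm_nonpositive : nonpositive_curvature metric }.

Section Convexity.
Variables (R : realType) (n : nat) (H : hadamard_manifold R n).
Implicit Types (p q : H) (E : set H) (f : H -> R).

Definition tvec := chart_index (atlas H) -> 'rV[R]_n.

(** For tangent [v] the geodesic exists by [hm_complete] and is unique by the
    Cauchy-Lipschitz theorem, so that the default value [p] is not used. *)
Definition expm p (v : tvec) : H :=
  xget p [set q | exists2 gam, geodesic_from (metric H) p v gam & gam 1 = q].

(** By the Cartan-Hadamard theorem [expm p] is a bijection from T_p(H) to H, so
    that exactly one [v] satisfies the condition. *)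
Definition expm_inv p q : tvec :=
  xget (0 : tvec) [set v | tangent (atlas H) p v /\ expm p v = q].

Definition geodesic_segment p q (alpha : R) : H :=
  expm p (alpha *: expm_inv p q).

Definition geodesic_convex E : Prop :=
  forall p q, E p -> E q -> forall alpha : R, 0 <= alpha <= 1 ->
    E (geodesic_segment p q alpha).

(** Functions on an open set [E] are represented by functions on [H]: for
    [p] in [E] the limits below do not depend on values outside [E]. *)
Definition diff_quotient f p (w : tvec) (alpha : R) : R :=
  (f (expm p (alpha *: w)) - f p) / alpha.

Definition dir_deriv f p (w : tvec) : R :=
  lim (diff_quotient f p w alpha @[alpha --> 0^'+]).

Definition dir_differentiable f p : Prop :=
  forall w, tangent (atlas H) p w ->
    cvg (diff_quotient f p w alpha @[alpha --> 0^'+]).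

Definition strictly_pseudoconvex E f pbar : Prop :=
  dir_differentiable f pbar /\
  forall p, E p -> p <> pbar -> f p <= f pbar ->
    dir_deriv f pbar (expm_inv pbar p) < 0.

End Convexity.

Record cb_interval (R : realType) := CBInterval {
  itv_lower : R;
  itv_upper : R;
  itv_lower_le_upper : itv_lower <= itv_upper }.

Definition itv_center (R : realType) (T : cb_interval R) : R :=
  2^-1 * (itv_lower T + itv_upper T).
Definition itv_half_width (R : realType) (T : cb_interval R) : R :=
  2^-1 * (itv_upper T - itv_lower T).

Definition le_LU (R : realType) (T S : cb_interval R) : Prop :=
  itv_lower T <= itv_lower S /\ itv_upper T <= itv_upper S.
Definition le_CW (R : realType) (T S : cb_interval R) : Prop :=
  itv_center T <= itv_center S /\ itv_half_width T <= itv_half_width S.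

Inductive component := CompL | CompU | CompC | CompW.

Definition part (R : realType) (X : component) (T : cb_interval R) : R :=
  match X with
  | CompL => itv_lower T
  | CompU => itv_upper T
  | CompC => itv_center T
  | CompW => itv_half_width T
  end.

Section IntervalFunctions.
Variables (R : realType) (n : nat) (H : hadamard_manifold R n).
Implicit Types (E : set H) (f : H -> cb_interval R).

Definition weakly_dir_differentiable f (p : H) : Prop :=
  dir_differentiable (fun q => itv_lower (f q)) p /\
  dir_differentiable (fun q => itv_upper (f q)) p.

Definition strictly_comp_pseudoconvex (X : component) E f (pbar : H) : Prop :=
  weakly_dir_differentiable f pbar /\
  strictly_pseudoconvex E (fun q => part X (f q)) pbar.

Definition feasible (m : nat) E (psi : 'I_m -> H -> R) : set H :=
  [set p | E p /\ forall u, psi u p <= 0].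

Definition strongly_pareto (le : cb_interval R -> cb_interval R -> Prop)
    (l : nat) (F : set H) (phi : 'I_l -> H -> cb_interval R) (pbar : H) : Prop :=
  F pbar /\
  ~ exists phat, [/\ F phat, phat <> pbar &
                     forall s, le (phi s phat) (phi s pbar)].

Definition strongly_pareto_I := strongly_pareto (@le_LU R).
Definition strongly_pareto_II := strongly_pareto (@le_CW R).

End IntervalFunctions.

(* Main.v *)
Require Import Defs.
From mathcomp Require Import all_boot all_order all_algebra.
From mathcomp Require Import all_classical all_reals all_analysis.
Import Order.TTheory GRing.Theory Num.Theory.
Import numFieldNormedType.Exports.
Local Open Scope classical_set_scope.
Local Open Scope ring_scope.

(** Suppose a feasible [phat <> pbar] were at least as good as [pbar], and let
    [w] be the initial velocity of the geodesic from [pbar] to [phat].  The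
    chosen component of the objective does not increase from [pbar] to [phat],
    so by strict pseudo-convexity its directional derivative along [w] is
    negative.  Every active constraint equals 0 at [pbar] and is nonpositive at
    [phat], so the same argument shows that it decreases along [w]; inactive
    constraints have multiplier 0 by complementary slackness.  The sum that the
    Karush-Kuhn-Tucker condition requires to be nonnegative is then negative.

    This only involves one real-valued objective ([kkt_unique_minimizer]).
    Both interval orders compare the intervals through two real components, so
    uniqueness of the minimizer for one component of one objective suffices for
    Pareto optimality ([kkt_strongly_pareto]). *)

(** Active constraints do not increase from [pbar] to [phat], so strict
    pseudo-convexity makes their derivatives negative; the multipliers of the
    inactive ones vanish. *)
Lemma multiplier_sum_le0 {R : realType} {n : nat} {H : hadamard_manifold R n}
    {E : set H} {t : nat} {psi : 'I_t -> H -> R} {mu : 'I_t -> R}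
    {pbar phat : H} :
  (forall u, psi u pbar = 0 -> strictly_pseudoconvex E (psi u) pbar) ->
  (forall u, 0 <= mu u) -> (forall u, mu u * psi u pbar = 0) ->
  feasible E psi phat -> phat <> pbar ->
  \sum_(u < t) mu u * dir_deriv (psi u) pbar (expm_inv pbar phat) <= 0.
Proof.
move=> psi_active mu_ge0 slack [Ephat psi_le0] phat_neq.
apply: sumr_le0 => u _.
have /eqP := slack u; rewrite mulf_eq0 => /orP[/eqP ->|/eqP psi0].
  by rewrite mul0r.
have [_ psi_decr] := psi_active u psi0.
apply: mulr_ge0_le0; first exact: mu_ge0.
by apply/ltW/psi_decr => //; rewrite psi0.
Qed.

(** If [f phat <= f pbar], then [f] would decrease strictly along the geodesic
    towards [phat] while the constraints contribute nothing positive.  Each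
    competitor is refuted along its own geodesic, so one fixed [phat] suffices
    here and the multipliers [mu] may depend on it. *)
Lemma kkt_unique_minimizer {R : realType} {n : nat} {H : hadamard_manifold R n}
    {E : set H} {t : nat} {f : H -> R} {psi : 'I_t -> H -> R}
    {mu : 'I_t -> R} {pbar phat : H} :
  (forall u, psi u pbar = 0 -> strictly_pseudoconvex E (psi u) pbar) ->
  strictly_pseudoconvex E f pbar ->
  [/\ forall u, 0 <= mu u,
      0 <= dir_deriv f pbar (expm_inv pbar phat)
           + \sum_(u < t) mu u * dir_deriv (psi u) pbar (expm_inv pbar phat)
    & forall u, mu u * psi u pbar = 0] ->
  feasible E psi phat -> phat <> pbar -> f pbar < f phat.
Proof.
move=> psi_active [_ f_decr] [mu_ge0 kkt slack] Fphat phat_neq.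
rewrite ltNge; apply/negP => f_le.
have df_lt0 := f_decr phat Fphat.1 phat_neq f_le.
have sum_le0 := multiplier_sum_le0
  psi_active mu_ge0 slack Fphat phat_neq.
by move: kkt; rewrite leNgt ltr_wnDr.
Qed.

(** A competitor that dominates [pbar] for [le] is in particular no worse in
    the component [X] of the objective [c], where [pbar] is the unique
    minimizer.  Both the LU order with [X] = L, U and the CW order with [X] = C,
    W are instances. *)
Lemma kkt_strongly_pareto {R : realType} {n : nat} {H : hadamard_manifold R n}
    {E : set H} {l t : nat} (le : cb_interval R -> cb_interval R -> Prop)
    (X : component) {phi : 'I_l -> H -> cb_interval R} {psi : 'I_t -> H -> R}
    {pbar : H} (c : 'I_l) :
  (forall T S, le T S -> part X T <= part X S) ->
  feasible E psi pbar ->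
  (forall u, psi u pbar = 0 -> strictly_pseudoconvex E (psi u) pbar) ->
  strictly_pseudoconvex E (fun q => part X (phi c q)) pbar ->
  (forall p : H, feasible E psi p ->
     exists mu : 'I_t -> R,
       [/\ forall u, 0 <= mu u,
           0 <= dir_deriv (fun q => part X (phi c q)) pbar (expm_inv pbar p)
                + \sum_(u < t)
                    mu u * dir_deriv (psi u) pbar (expm_inv pbar p)
         & forall u, mu u * psi u pbar = 0]) ->
  strongly_pareto le (feasible E psi) phi pbar.
Proof.
move=> le_part Fpbar psi_active phi_pc kkt.
split=> // -[phat [Fphat phat_neq phat_le]].
have [mu kkt_mu] := kkt phat Fphat.
have := kkt_unique_minimizer psi_active phi_pc kkt_mu
  Fphat phat_neq.
by rewrite ltNge le_part.
Qed.

Theorem theorem3p7 (R : realType) (n : nat) (H : hadamard_manifold R n)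
    (E : set H) (E_nonempty : E !=set0) (E_open : open E)
    (E_convex : geodesic_convex E)
    (l t : nat) (phi : 'I_l -> H -> cb_interval R) (psi : 'I_t -> H -> R)
    (F_convex : geodesic_convex (feasible E psi))
    (pbar : H) (pbar_feasible : feasible E psi pbar)
    (psi_diff : forall u : 'I_t, dir_differentiable (psi u) pbar)
    (psi_active : forall u : 'I_t, psi u pbar = 0 ->
       strictly_pseudoconvex E (psi u) pbar)
    (c : 'I_l) (phi_diff : weakly_dir_differentiable (phi c) pbar) :
  (forall X : component, X = CompL \/ X = CompU ->
     strictly_comp_pseudoconvex X E (phi c) pbar ->
     (forall p : H, feasible E psi p ->
        exists mu : 'I_t -> R,
          [/\ forall u, 0 <= mu u,
              0 <= dir_deriv (fun q => part X (phi c q)) pbar (expm_inv pbar p)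
                   + \sum_(u < t)
                       mu u * dir_deriv (psi u) pbar (expm_inv pbar p)
            & forall u, mu u * psi u pbar = 0]) ->
     strongly_pareto_I (feasible E psi) phi pbar) /\
  (forall X : component, X = CompC \/ X = CompW ->
     strictly_comp_pseudoconvex X E (phi c) pbar ->
     (forall p : H, feasible E psi p ->
        exists mu : 'I_t -> R,
          [/\ forall u, 0 <= mu u,
              0 <= dir_deriv (fun q => part X (phi c q)) pbar (expm_inv pbar p)
                   + \sum_(u < t)
                       mu u * dir_deriv (psi u) pbar (expm_inv pbar p)
            & forall u, mu u * psi u pbar = 0]) ->
     strongly_pareto_II (feasible E psi) phi pbar).
Proof.
split=> X HX [_ phi_pc] kkt; apply: (kkt_strongly_pareto _ X c) => //.
- by move=> T S [leL leU]; case: HX => ->.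
- by move=> T S [leC leW]; case: HX => ->.
Qed.
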